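(* Let $U\subseteq V=H\otimes E$ be any subspace. Then $U$ can be written in each of the following forms: (1) $U=(h\otimes F')\oplus U^{F'',T''}$ for some $h\in H$, some subspace $F'\subseteq E$, and a $U^{F,T}$ subspace $U^{F'',T''}$ which has maximal dimension among all $U^{F,T}$ subspaces contained in $U$; (2) $U=(k_1\otimes F_1)\oplus\cdots\oplus(k_s\otimes F_s)\oplus U^{\widetilde F,\widetilde T}$ with $k_1,\dots,k_s\in H$ pairwise linearly independent, $F_1,\dots,F_s\subseteq E$ subspaces, and $U^{\widetilde F,\widetilde T}$ a $U^{F,T}$ subspace which has maximal dimension among all $U^{F,T}$ subspaces contained in $U$ that contain no decomposable subspace.
   Context: $H$ is a real vector space of dimension $2$ with a symplectic (volume) form $\omega^H$, $E$ is a real vector space of dimension $2n$, and $V=H\otimes E$. A symplectic basis $(h_1,h_2)$ of $H$ is a basis with $\omega^H=h_1^*\wedge h_2^*$, i.e. $\omega^H(h_1,h_2)=1$. For a symplectic basis $(h_1,h_2)$, a subspace $F\subseteq E$ and a linear map $T:F\to E$, put $U^{F,T}=\{h_1\otimes f+h_2\otimes Tf : f\in F\}$. A subspace of $V$ is called a $U^{F,T}$ subspace if it has this form with respect to some symplectic basis of $H$ (different $U^{F,T}$ subspaces may use different symplectic bases). For $h\in H$ and a subspace $E'\subseteq E$, $h\otimes E'=\{h\otimes e: e\in E'\}$; a decomposable subspace is a nonzero subspace of this form. In the decompositions, summands are allowed to be zero and $s=0$ is allowed. *)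

(* Defs.v *)
From HB Require Import structures.
From mathcomp Require Import all_boot all_order all_algebra.

Set Implicit Arguments.
Unset Strict Implicit.
Unset Printing Implicit Defensive.

Import Order.TTheory GRing.Theory Num.Theory.

Local Open Scope ring_scope.

(* [(V, t)] is a tensor product of [H] and [E]: the universal property. *)
Definition is_tensor_product (K : fieldType) (H E V : vectType K)
    (t : {bilinear H -> E -> V}) : Prop :=
  forall (W : lmodType K) (b : {bilinear H -> E -> W}),
    exists f : {linear V -> W},
      (forall h e, f (t h e) = b h e) /\
      (forall g : {linear V -> W}, (forall h e, g (t h e) = b h e) -> g =1 f).

Section TensorSubspaces.

Variables (K : fieldType) (H E V : vectType K).
Variables (t : {bilinear H -> E -> V}) (omega : {skew_symmetric H}).

(* Only one pairing has to be prescribed: for a basis of the plane [H],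
   [omega = h1^* /\ h2^*] amounts to [omega h1 h2 = 1]. *)
Definition symplectic_basis (h1 h2 : H) : Prop :=
  basis_of fullv [:: h1; h2] /\ omega h1 h2 = 1.

(* h (x) F = {h (x) f : f in F} *)
Definition tensv (h : H) (F : {vspace E}) : {vspace V} :=
  (linfun (t h) @: F)%VS.

(* U^{F,T} = {h1 (x) f + h2 (x) T f : f in F}, with T : F -> E linear *)
Definition graph_tensv (h1 h2 : H) (F : {vspace E})
    (T : 'Hom(subvs_of F, E)) : {vspace V} :=
  limg ((linfun (t h1) \o linfun vsval)%VF + (linfun (t h2) \o T)%VF).

(* The symplectic basis is part of the existential: two such subspaces need
   not share it. *)
Definition is_UFT (W : {vspace V}) : Prop :=
  exists h1 h2 : H, exists (F : {vspace E}) (T : 'Hom(subvs_of F, E)),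
    symplectic_basis h1 h2 /\ W = graph_tensv h1 h2 T.

Definition decomposable (D : {vspace V}) : Prop :=
  D <> 0%VS /\ exists (h : H) (F : {vspace E}), D = tensv h F.

Definition decomposable_free (W : {vspace V}) : Prop :=
  forall D : {vspace V}, decomposable D -> ~ (D <= W)%VS.

Definition maximal_dim (P : {vspace V} -> Prop) (W : {vspace V}) : Prop :=
  P W /\ forall W' : {vspace V}, P W' -> (\dim W' <= \dim W)%N.

Lemma mem_tensv (h : H) (F : {vspace E}) (v : V) :
  reflect (exists2 f, f \in F & v = t h f) (v \in tensv h F).
Proof.
by apply: (iffP memv_imgP) => -[f Ff ->]; exists f; rewrite // lfunE.
Qed.

Lemma mem_graph_tensv (h1 h2 : H) (F : {vspace E}) (T : 'Hom(subvs_of F, E)) (v : V) :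
  reflect (exists f : subvs_of F, v = t h1 (vsval f) + t h2 (T f))
          (v \in graph_tensv h1 h2 T).
Proof.
apply: (iffP memv_imgP) => [[f _ ->]|[f ->]]; exists f; rewrite ?memvf //;
  by rewrite add_lfunE !comp_lfunE !lfunE.
Qed.

End TensorSubspaces.

(* Main.v *)
(** Over a basis [h1, h2] of [H], a subspace [W] is of the form [U^{F,T}] exactly
    when [W] meets [h2 (x) E] trivially.

    For (1), let [W] be a [U^{F,T}] subspace of [U], for the basis [h1, h2], of
    maximal dimension: any complement of the intersection of [U] with [h2 (x) E]
    in [U] is again of this form, so [W] itself must be such a complement.

    For (2), a subspace without decomposable subspace is automatically [U^{F,T}].
    Let [W] be one in [U] of maximal dimension.  If [W <= W' < U], then [U] has a
    pure tensor outside [W']: otherwise, for [u] in [U] outside [W'], every pure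
    tensor of [W + <u>] would lie in the intersection of [W + <u>] with [W'],
    which is [W], so that [W + <u>] would contradict the maximality of [W].
    Hence [W] has a complement in [U] with a basis of pure tensors [h (x) f], which
    are then grouped according to the line spanned by [h]. *)
Require Import Defs.
From HB Require Import structures.
From mathcomp Require Import all_boot all_order all_algebra.
From mathcomp Require Import reals.
From Stdlib Require Import Classical.

Set Implicit Arguments.
Unset Strict Implicit.
Unset Printing Implicit Defensive.

Import Order.TTheory GRing.Theory Num.Theory.

Local Open Scope ring_scope.

(** * Subspaces of maximal dimension *)

Lemma maximal_dim_exists (K : fieldType) (V : vectType K)
    (P : {vspace V} -> Prop) (W0 : {vspace V}) :
  P W0 -> exists W, maximal_dim P W.
Proof.
have [m] := ubnP (\dim {:V} - \dim W0); elim: m W0 => // m IHm W0 ltm PW0.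
(* [P] is an arbitrary proposition, so the case split is classical; a larger witness lowers the
   codimension, on which the induction runs. *)
have [max0|nomax] := classic (forall W, P W -> (\dim W <= \dim W0)%N).
  by exists W0.
have [W1 notmax1] := not_all_ex_not _ _ nomax.
have [PW1 /negP] := imply_to_and _ _ notmax1.
rewrite -ltnNge => lt01; apply: (IHm W1) => //.
rewrite -ltnS; apply: leq_trans ltm; rewrite ltnS ltn_sub2l //.
by apply: leq_trans lt01 _; apply/dimvS/subvf.
Qed.

Lemma dimv_addv_line_notin (K : fieldType) (V : vectType K)
    (W : {vspace V}) (v : V) :
  v \notin W -> \dim (W + <[v]>) = (\dim W).+1.
Proof.
move=> vW; rewrite dimv_disjoint_sum.
  by rewrite dim_vline (memPnC vW) ?mem0v // addn1.
apply/eqP; rewrite -subv0; apply/subvP=> x /memv_capP[xW /vlineP[c def_x]].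
rewrite memv0 def_x; have [->|c_neq0] := eqVneq c 0; first by rewrite scale0r.
by move: xW; rewrite def_x rpredZeq (negPf c_neq0) (negPf vW).
Qed.

(** * Pure tensors and decomposable subspaces *)

Section Tensors.

Variables (K : fieldType) (H E V : vectType K) (t : {bilinear H -> E -> V}).

Lemma mem_tensv_self (h : H) (f : E) (F : {vspace E}) :
  f \in F -> t h f \in tensv t h F.
Proof. by move=> fF; apply/mem_tensv; exists f. Qed.

Lemma tensvD (h : H) (F1 F2 : {vspace E}) :
  tensv t h (F1 + F2) = (tensv t h F1 + tensv t h F2)%VS.
Proof. exact: limgD. Qed.

Lemma tensv_line (h : H) (f : E) : tensv t h <[f]> = <[t h f]>%VS.
Proof. by rewrite /tensv limg_line lfunE. Qed.

Lemma dim_tensv (h : H) (F : {vspace E}) : (\dim (tensv t h F) <= \dim F)%N.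
Proof. by rewrite -(limg_ker_dim (linfun (t h)) F) leq_addl. Qed.

Lemma tensv_full_cap (h : H) (U : {vspace V}) :
  exists F, (U :&: tensv t h fullv)%VS = tensv t h F.
Proof.
exists (linfun (t h) @^-1: U)%VS; apply/vspaceP=> v; rewrite memv_cap.
apply/andP/mem_tensv => [[vU /mem_tensv[f _ def_v]]|[f]].
  by exists f => //; rewrite -memv_preim lfunE /= -def_v.
by rewrite -memv_preim lfunE => fU ->; split; last exact/mem_tensv_self/memvf.
Qed.

(** A nonzero pure tensor spans a decomposable line, and a decomposable subspace consists of pure
    tensors. *)
Lemma decomposable_free_pure (W : {vspace V}) :
  decomposable_free t W <-> forall h f, t h f \in W -> t h f = 0.
Proof.
split=> [freeW h f tW | pureW D [D0 [h [F defD]]] DW].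
  apply/eqP/negPn/negP=> tn0; apply: (freeW (tensv t h <[f]>%VS)).
    split; last by exists h, <[f]>%VS.
    by rewrite tensv_line => /eqP; rewrite -subv0 -memvE memv0; apply/negP.
  by rewrite tensv_line -memvE.
case: D0; apply/eqP; rewrite -subv0 defD; apply/subvP=> v /mem_tensv[f fF def_v].
rewrite memv0 def_v; apply/eqP/pureW; apply: (subvP DW).
by rewrite defD; apply: mem_tensv_self.
Qed.

(* Directness is recorded as a bound on dimensions, which is easier to carry
   through the insertion of one pure tensor at a time. *)
Lemma grouped_pure_tensors_insert (ks : seq H) (F : H -> {vspace E})
    (h : H) (f : E) :
    uniq ks -> {in ks &, forall x y, x != y -> free [:: x; y]} ->
    0 \notin ks -> h != 0 ->
  exists ks' F',
    [/\ uniq ks', {in ks' &, forall x y, x != y -> free [:: x; y]}, 0 \notin ks',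
        (\sum_(k <- ks') tensv t k (F' k) =
           \sum_(k <- ks) tensv t k (F k) + <[t h f]>)%VS
      & (\sum_(k <- ks') \dim (F' k) <= (\sum_(k <- ks) \dim (F k)).+1)%N].
Proof.
move=> Uks freeks ks0 h0.
have [/hasP[k kks /vlineP[c def_h]]|/hasPn noline] :=
    boolP (has (fun k => h \in <[k]>%VS) ks).
  have c0 : c != 0 by apply: contraNneq h0 => c0; rewrite def_h c0 scale0r.
  (* As [h] is a nonzero multiple of [k], the scalar is dropped and [f] joins the factor of [k]. *)
  exists ks, (fun x => if x == k then (F x + <[f]>)%VS else F x); split=> //.
    rewrite !(big_rem k kks) /= eqxx tensvD tensv_line.
    rewrite (eq_big_seq (fun x => tensv t x (F x))); last first.
      by move=> x; rewrite mem_rem_uniq // inE => /andP[/negPf->].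
    have -> : <[t h f]>%VS = <[t k f]>%VS.
      apply/eqP; rewrite eqEdim -memvE def_h linearZl_LR memvZ ?memv_line //.
      by rewrite !dim_vline scaler_eq0 (negPf c0) /=.
    by rewrite -!addvA [(<[_]> + _)%VS]addvC.
  rewrite !(big_rem k kks) /= eqxx.
  rewrite (eq_big_seq (fun x => \dim (F x))); last first.
    by move=> x; rewrite mem_rem_uniq // inE => /andP[/negPf->].
  rewrite -addSn leq_add2r (leq_trans (dimv_add_leqif _ _)) //.
  by rewrite -addn1 leq_add2l dim_vline leq_b1.
have hks : h \notin ks by apply/negP=> /noline; rewrite memv_line.
(* Here [h] spans a new line and opens a group of its own. *)
exists (h :: ks), (fun x => if x == h then <[f]>%VS else F x).
have Fks : {in ks, (fun x => if x == h then <[f]>%VS else F x) =1 F}.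
  by move=> x xks; case: eqP => // xh; rewrite xh (negPf hks) in xks.
(* Freeness needs [k] nonzero, hence the invariant [0 \notin ks]. *)
have free_h k : k \in ks -> free [:: h; k].
  move=> kks; rewrite free_cons span_seq1 noline //= seq1_free.
  by apply: contraNneq ks0 => <-.
split; rewrite /= ?hks ?inE ?negb_or ?[0 == _]eq_sym ?h0 //.
- move=> x y; rewrite !inE => /predU1P[->|xks] /predU1P[->|yks].
  + by rewrite eqxx.
  + by move=> _; apply: free_h.
  + by rewrite (perm_free (permEl (perm_catC [:: x] [:: h]))) => _; apply: free_h.
  + exact: freeks.
- rewrite big_cons eqxx tensv_line addvC; congr (_ + _)%VS.
  by apply: eq_big_seq => x /Fks->.
- rewrite big_cons eqxx dim_vline -addn1 addnC leq_add ?leq_b1 //.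
  by rewrite (eq_big_seq (fun x => \dim (F x))) // => x /Fks->.
Qed.

(** Each inserted tensor lies outside the current sum, whose dimension grows by exactly one, while
    the total of the [\dim (F k)] grows by at most one; this preserves the dimension bound. *)
Lemma grouped_pure_tensors_exists (U W : {vspace V}) :
    (W <= U)%VS ->
    (forall W' : {vspace V}, (W <= W')%VS -> (W' <= U)%VS -> W' != U ->
       exists h f, t h f \in U /\ t h f \notin W') ->
  exists (ks : seq H) (F : H -> {vspace E}),
    [/\ uniq ks, {in ks &, forall x y, x != y -> free [:: x; y]},
        U = (\sum_(k <- ks) tensv t k (F k) + W)%VS
      & (\sum_(k <- ks) \dim (F k) + \dim W <= \dim U)%N].
Proof.
move=> WU pureU.
suffices step m : exists (ks : seq H) (F : H -> {vspace E}),
  let S := (\sum_(k <- ks) tensv t k (F k) + W)%VS in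
  [/\ uniq ks /\ 0 \notin ks, {in ks &, forall x y, x != y -> free [:: x; y]},
      (S <= U)%VS, (\sum_(k <- ks) \dim (F k) + \dim W <= \dim S)%N
    & S = U \/ (m <= \dim S)%N].
  (* With [m] beyond [\dim U] only the alternative [S = U] survives. *)
  have [ks [F [[Uks ks0] freeks SU dimS [defU|big]]]] := step (\dim U).+1.
    by exists ks, F; split; rewrite // -?defU.
  by have := leq_trans big (dimvS SU); rewrite ltnn.
elim: m => [|m [ks [F [[Uks ks0] freeks SU dimS bigS]]]].
  exists [::], (fun=> 0%VS); rewrite /= !big_nil add0v; split=> //; first by right.
set S := (_ + W)%VS in SU dimS bigS.
have [defU|neqU] := eqVneq S U; first by exists ks, F; split=> //; left.
have [h [f [tU tS]]] := pureU S (addvSr _ _) SU neqU.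
have h0 : h != 0 by apply: contraNneq tS => ->; rewrite linear0l mem0v.
have [ks' [F' [Uks' freeks' ks0' sumks' dimks']]] :=
  grouped_pure_tensors_insert F f Uks freeks ks0 h0.
exists ks', F' => /=; rewrite sumks' -addvA [(<[_]> + _)%VS]addvC addvA.
rewrite -/S dimv_addv_line_notin //; split=> //.
- by rewrite subv_add SU -memvE.
- by rewrite (leq_trans (leq_add dimks' (leqnn _))) // addSn ltnS.
- by right; case: bigS => // defU; rewrite defU eqxx in neqU.
Qed.

Lemma pure_tensor_outside (U W W' : {vspace V}) :
    maximal_dim (fun X => (X <= U)%VS /\ decomposable_free t X) W ->
    (W <= W')%VS -> (W' <= U)%VS -> W' != U ->
  exists h f, t h f \in U /\ t h f \notin W'.
Proof.
move=> [[WU /decomposable_free_pure freeW] maxW] WW' W'U neqU.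
apply: NNPP => /not_ex_all_not noout.
have tW' h f : t h f \in U -> t h f \in W'.
  move=> tU; apply/negPn/negP=> tW'.
  by apply: (noout h); exists f.
have [u uU uW'] : exists2 u, u \in U & u \notin W'.
  by apply/subvPn; apply: contraNN neqU => UW'; rewrite eqEsubv W'U.
have uW : u \notin W by apply: contraNN uW' => /(subvP WW').
have WuU : (W + <[u]> <= U)%VS by rewrite subv_add WU -memvE.
suffices freeWu : decomposable_free t (W + <[u]>)%VS.
  by have := maxW _ (conj WuU freeWu); rewrite dimv_addv_line_notin // ltnn.
apply/decomposable_free_pure => h f tWu; apply: freeW.
have := tW' h f (subvP WuU _ tWu).
have /memv_addP[w wW [_ /vlineP[c ->] ->]] := tWu.
have [->|c0] := eqVneq c 0; first by rewrite scale0r addr0.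
(* For nonzero [c], having [w + c *: u] in [W'] would force [u] into [W']. *)
rewrite rpredDl => [cuW'|]; last exact: (subvP WW').
case/negP: uW'.
by rewrite -(scalerK c0 u) memvZ.
Qed.

End Tensors.

(** * Coordinates on the tensor product *)

Section BilinearCoordinate.

Variables (K : fieldType) (H E : vectType K) (X : 2.-tuple H) (i : 'I_2).

(** The universal property turns this map, for each [i], into a projection of [V] onto a copy of
    [E]. *)
Definition bilinear_coord (h : H) (e : E) : E := coord X i h *: e.

Lemma bilinear_coord_subproof :
  bilinear_for (GRing.Scale.Law.clone _ _ *:%R _)
    (GRing.Scale.Law.clone _ _ *:%R _) bilinear_coord.
Proof.
split=> [e|h] a x y /=; rewrite /bilinear_coord.
  by rewrite linearP scalerDl scalerA.
by rewrite scalerDr !scalerA mulrC.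
Qed.

HB.instance Definition _ :=
  bilinear_isBilinear.Build K H E E _ _ bilinear_coord bilinear_coord_subproof.

End BilinearCoordinate.

(** * Symplectic bases and graph subspaces *)

Section SymplecticBases.

Variables (K : fieldType) (H E V : vectType K) (t : {bilinear H -> E -> V}).
Variable omega : {skew_symmetric H}.
Hypothesis tensorV : is_tensor_product t.

Lemma tensor_coordinates (h1 h2 : H) :
    basis_of fullv [:: h1; h2] ->
  exists f1 f2 : {linear V -> E},
    [/\ forall v, v = t h1 (f1 v) + t h2 (f2 v),
        forall a b, f1 (t h1 a + t h2 b) = a
      & forall e, f1 (t h2 e) = 0].
Proof.
move=> basisX; pose X : 2.-tuple H := [tuple h1; h2].
have freeX : free X := basis_free basisX.
have [f1 [f1E _]] := tensorV (bilinear_coord X ord0 : {bilinear H -> E -> E}).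
have [f2 [f2E _]] := tensorV (bilinear_coord X ord_max : {bilinear H -> E -> E}).
have coordX (i j : 'I_2) : coord X i (tnth X j) = (i == j)%:R.
  by rewrite (tnth_nth 0) coord_free // eq_sym.
have f1h1 e : f1 (t h1 e) = e.
  by rewrite f1E /= /bilinear_coord [coord _ _ _](coordX ord0 ord0) scale1r.
have f1h2 e : f1 (t h2 e) = 0.
  by rewrite f1E /= /bilinear_coord [coord _ _ _](coordX ord0 ord_max) scale0r.
exists f1, f2; split=> // [v|a b]; last by rewrite linearD f1h1 f1h2 addr0.
(* The identity and [g] both extend [t], so uniqueness in the universal property makes them
   equal. *)
have [id' [_ uniq_id]] := tensorV t.
pose g := ((linfun (t h1) \o linfun f1) + (linfun (t h2) \o linfun f2))%VF.
have gE x : g x = t h1 (f1 x) + t h2 (f2 x).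
  by rewrite add_lfunE !comp_lfunE !lfunE.
rewrite -gE (uniq_id g) => [|h e].
  by have := uniq_id idfun (fun _ _ => erefl) v.
have def_h : h = coord X ord0 h *: h1 + coord X ord_max h *: h2.
  rewrite {1}(coord_basis basisX (memvf h)) !big_ord_recl big_ord0 addr0 /=.
  by congr (_ + coord _ _ _ *: _); apply: val_inj.
rewrite [LHS]gE f1E f2E /= /bilinear_coord !linearZ_LR -!linearZl_LR -linearDl.
by rewrite -def_h.
Qed.

(** The first coordinate [f1] is injective on [W], since a vector it kills has the form [t h2 e].
    Thus [W] is a graph over [F], its image under [f1], and [T] is the second coordinate after the
    inverse. *)
Lemma is_UFT_of_transversal (h1 h2 : H) (W : {vspace V}) :
    symplectic_basis omega h1 h2 ->
    (forall e, t h2 e \in W -> t h2 e = 0) ->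
  is_UFT t omega W.
Proof.
move=> sympl transW; have [f1 [f2 [f12E f1E f1h2]]] := tensor_coordinates sympl.1.
pose g := (linfun f1 \o linfun (vsval : subvs_of W -> V))%VF.
have gE x : g x = f1 (vsval x) by rewrite comp_lfunE !lfunE.
have gK : cancel g g^-1%VF.
  apply: lker0_lfunK; rewrite -subv0; apply/subvP=> x.
  rewrite memv_ker gE memv0 => /eqP f1x.
  have def_x : vsval x = t h2 (f2 (vsval x)).
    by rewrite {1}[vsval x]f12E f1x linear0r add0r.
  by apply/eqP/val_inj; rewrite /= def_x; apply: transW; rewrite -def_x subvsP.
pose F := limg g.
pose T : 'Hom(subvs_of F, E) :=
  (linfun f2 \o linfun vsval \o g^-1 \o linfun vsval)%VF.
have TE f : T f = f2 (vsval (g^-1%VF (vsval f))) by rewrite !comp_lfunE !lfunE.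
exists h1, h2, F, T; split=> //; apply/vspaceP=> v; apply/idP/mem_graph_tensv.
  move=> vW; have gxF : g (Subvs vW) \in F by rewrite memv_img ?memvf.
  by exists (Subvs gxF); rewrite TE [vsval (Subvs gxF)]/= gK gE -f12E.
case=> f ->; have /memv_imgP[x _ def_f] := subvsP f.
by rewrite TE def_f gK gE -f12E subvsP.
Qed.

(** On the graph [f1] recovers [f], whereas it vanishes on every [t h2 e]. *)
Lemma is_UFT_transversal (W : {vspace V}) :
    is_UFT t omega W ->
  exists h1 h2, symplectic_basis omega h1 h2 /\ (W :&: tensv t h2 fullv = 0)%VS.
Proof.
case=> h1 [h2 [F [T [sympl ->]]]]; exists h1, h2; split=> //.
have [f1 [f2 [_ f1E f1h2]]] := tensor_coordinates sympl.1.
apply/eqP; rewrite -subv0; apply/subvP=> v.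
rewrite memv_cap memv0 => /andP[/mem_graph_tensv[f def_v] /mem_tensv[e _ def_v']].
have f0 : f = 0.
  by apply: val_inj; rewrite /= -(f1E (vsval f) (T f)) -def_v def_v' f1h2.
by rewrite def_v f0 !linear0 addr0.
Qed.

End SymplecticBases.

Lemma symplectic_basis_exists (K : fieldType) (H : vectType K)
    (omega : {skew_symmetric H}) :
    \dim {:H} = 2%N -> is_psymplectic omega ->
  exists h1 h2, symplectic_basis omega h1 h2.
Proof.
move=> dimH [/eqP nondeg _ pchar2_alt].
(* In characteristic two this is part of [is_psymplectic]; otherwise skew symmetry gives it. *)
have alt x : omega x x = 0.
  have [/pchar2_alt//|char_not2] := boolP (2%N \in [pchar K]).
  have := hermC omega x x; rewrite expr1 mulN1r => /eqP.
  rewrite -addr_eq0 -mulr2n -mulr_natl mulf_eq0.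
  by move: char_not2; rewrite inE /= => /negPf-> /eqP.
pose h := vpick {:H}.
have h0 : h != 0 by rewrite vpick0 -dimv_eq0 dimH.
have /mem_orthovPn[h2 _ omega_n0] : h \notin orthov omega fullv.
  by rewrite nondeg memv0.
(* Rescaling normalises the pairing with [h2] to 1. *)
pose h1 := (omega h h2)^-1 *: h.
have omega12 : omega h1 h2 = 1 by rewrite linearZl_LR /= mulVf.
exists h1, h2; split=> //.
rewrite basisEfree subvf dimH leqnn !andbT free_cons span_seq1 seq1_free.
apply/andP; split; last first.
  by apply: contra_eq_neq omega12 => ->; rewrite linear0r eq_sym oner_eq0.
apply/negP=> /vlineP[c def_h1]; move/eqP: omega12.
by rewrite def_h1 linearZl_LR /= alt mulr0 eq_sym oner_eq0.
Qed.

(** * The two decompositions *)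

Lemma is_UFT_complement (K : fieldType) (H E V : vectType K)
    (t : {bilinear H -> E -> V}) (omega : {skew_symmetric H})
    (tensorV : is_tensor_product t) (U W : {vspace V}) :
    maximal_dim (fun W' => is_UFT t omega W' /\ (W' <= U)%VS) W ->
  exists h F, U = (tensv t h F + W)%VS /\ directv (tensv t h F + W).
Proof.
move=> [[/(is_UFT_transversal tensorV)[h1 [h2 [sympl WE]]] WU] maxW].
have [F defF] := tensv_full_cap t h2 U; exists h2, F; rewrite -defF.
set G := (U :&: _)%VS.
have GW : (G :&: W = 0)%VS.
  by apply/eqP; rewrite -subv0 -WE capvC capvS ?capvSr.
split; last by apply/directv_addP.
have UFT_compl : is_UFT t omega (U :\: G)%VS.
  apply: (is_UFT_of_transversal tensorV sympl) => e te.
  have teU : t h2 e \in U by apply: subvP te; apply: diffvSl.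
  have : t h2 e \in (G :&: (U :\: G))%VS.
    by rewrite !memv_cap teU te mem_tensv_self ?memvf.
  by rewrite capvC capv_diff memv0 => /eqP.
(* Maximality of [W] bounds the dimension of the complement [U :\: G], so [G + W] is large enough to
   fill [U]. *)
apply/eqP; rewrite eq_sym eqEdim subv_add capvSl WU /= dimv_disjoint_sum //.
rewrite -(dimv_cap_compl U G) leq_add ?maxW ?diffvSl //.
by rewrite dimvS // capvSr.
Qed.

Theorem proposition3p4 (R : realType) (n : nat) (H E V : vectType R)
    (t : {bilinear H -> E -> V}) (omega : {skew_symmetric H})
    (dimH : \dim {:H} = 2%N) (dimE : \dim {:E} = (2 * n)%N)
    (omega_sympl : is_psymplectic omega)
    (tensorV : is_tensor_product t)
    (U : {vspace V}) :
  (exists (h : H) (F' : {vspace E}) (W : {vspace V}),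
     [/\ U = (tensv t h F' + W)%VS,
         directv (tensv t h F' + W)
       & maximal_dim (fun W' => is_UFT t omega W' /\ (W' <= U)%VS) W]) /\
  (exists (s : nat) (k : 'I_s -> H) (F : 'I_s -> {vspace E})
          (W : {vspace V}),
     [/\ (forall i j : 'I_s, i != j -> free [:: k i; k j]),
         U = (\sum_(i < s) tensv t (k i) (F i) + W)%VS,
         directv (\sum_(i < s) tensv t (k i) (F i) + W)
       & maximal_dim (fun W' => [/\ is_UFT t omega W', (W' <= U)%VS
                                  & decomposable_free t W']) W]).

Proof.
have [h1 [h2 sympl]] := symplectic_basis_exists dimH omega_sympl.
split.
  have UFT0 : is_UFT t omega 0 /\ (0 <= U)%VS.
    split; last exact: sub0v.
    by apply: (is_UFT_of_transversal tensorV sympl) => e; rewrite memv0 => /eqP.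
  have [W maxW] :=
    maximal_dim_exists (P := fun X => is_UFT t omega X /\ (X <= U)%VS) UFT0.
  have [h [F [defU dirU]]] := is_UFT_complement tensorV maxW.
  by exists h, F, W.
have free0 : (0 <= U)%VS /\ decomposable_free t 0%VS.
  split; first exact: sub0v.
  by apply/decomposable_free_pure => h f; rewrite memv0 => /eqP.
(* The graph condition is left out of this maximum and recovered at the end. *)
have [W maxW] :=
  maximal_dim_exists (P := fun X => (X <= U)%VS /\ decomposable_free t X) free0.
have [[WU freeW] dimW] := maxW.
have [ks [F [Uks freeks defU dimU]]] :=
  grouped_pure_tensors_exists WU (fun W' => pure_tensor_outside maxW (W' := W')).
pose k := tnth (in_tuple ks).
have sumE : (\sum_(i < size ks) tensv t (k i) (F (k i)) =
    \sum_(k <- ks) tensv t k (F k))%VS.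
  by rewrite [RHS](big_tnth _ _ ks).
exists (size ks), k, (F \o k), W.
split.
- move=> i j neq_ij; apply: freeks; rewrite ?mem_tnth //.
  by rewrite (inj_eq (tuple_uniqP (in_tuple ks) Uks)).
- by rewrite sumE.
(* The bound [dimU] together with [dim_tensv] forces directness. *)
- rewrite directvEgeq /= sumE -defU (leq_trans _ dimU) // leq_add2r.
  by rewrite (big_tnth _ _ ks) leq_sum // => i _; apply: dim_tensv.
- split; last by move=> W' [_ W'U freeW']; apply: dimW.
  split=> //; apply: (is_UFT_of_transversal tensorV sympl) => e.
  by move/decomposable_free_pure: freeW; apply.
Qed.
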